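(* Let $R=-y\partial_x+x\partial_y$ on $\mathbb{S}^2\times\mathbb{R}$. The only rotational $R$-solitons (rotational with respect to an arbitrary axis of $\mathbb{S}^2$) are: (1) slices $\mathbb{S}^2\times\{t_0\}$, $t_0\in\mathbb{R}$, viewed as rotational surfaces with respect to any axis of $\mathbb{S}^2$; and (2) rotational minimal surfaces about the $z$-axis.
   Context: $\mathbb{S}^2$ is the unit sphere of $\mathbb{R}^3$, and $\mathbb{S}^2\times\mathbb{R}\subset\mathbb{R}^4$ carries the product metric with coordinates $(x,y,z,t)$, $x^2+y^2+z^2=1$. $R=-y\partial_x+x\partial_y$ is the Killing field of rotations about the $z$-axis of $\mathbb{S}^2$. The mean curvature $H$ is the sum of the principal curvatures with respect to a unit normal $N$; a surface is an $R$-soliton if $H=\langle N,R\rangle$ on it, and minimal if $H=0$. A rotational surface is a surface invariant under the one-parameter group of isometries $(p,t)\mapsto(\rho(p),t)$, where $\rho$ ranges over the rotations of $\mathbb{S}^2$ about a fixed axis (a line through the origin of $\mathbb{R}^3$); this axis is not a priori assumed to be the $z$-axis. In coordinates of $\mathbb{R}^3$ for which the rotation axis is the third coordinate axis, a rotational surface is parametrized by $(s,\varphi)\mapsto(\cos u(s)\cos\varphi,\cos u(s)\sin\varphi,\sin u(s),v(s))$, where $\cos u\neq 0$, $u'=\cos\theta$, $v'=\sin\theta$ for a smooth function $\theta$. *)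

(* Defs.v *)
From HB Require Import structures.
From mathcomp Require Import all_boot all_order all_algebra.
From mathcomp Require Import all_classical all_reals all_analysis.

Set Implicit Arguments.
Unset Strict Implicit.
Unset Printing Implicit Defensive.

Import Order.TTheory GRing.Theory Num.Theory.
Import numFieldNormedType.Exports.

Local Open Scope classical_set_scope.
Local Open Scope ring_scope.

Section Ambient.
Context {R : realType}.

Definition dot n (u v : 'rV[R]_n) : R := \sum_(i < n) u 0 i * v 0 i.

Definition cross (u v : 'rV[R]_3) : 'rV[R]_3 :=
  \row_i [:: u 0 1 * v 0 2 - u 0 2 * v 0 1;
             u 0 2 * v 0 0 - u 0 0 * v 0 2;
             u 0 0 * v 0 1 - u 0 1 * v 0 0]`_i.

(* A point of R^4 is (x, y, z, t), split as (x, y, z) and t. *)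
Definition r3part (p : 'rV[R]_4) : 'rV[R]_3 := @lsubmx R 1 3 1 p.
Definition tcoord (p : 'rV[R]_4) : R := p 0 3.
Definition pt4 (v : 'rV[R]_3) (t : R) : 'rV[R]_4 :=
  @row_mx R 1 3 1 v (const_mx t).

Definition S2xR : set 'rV[R]_4 := [set p | dot (r3part p) (r3part p) = 1].

Definition slice (t0 : R) : set 'rV[R]_4 := S2xR `&` [set p | tcoord p = t0].

Definition e_z : 'rV[R]_3 := delta_mx 0 2.

(* R = - y d/dx + x d/dy *)
Definition Rfield (p : 'rV[R]_4) : 'rV[R]_4 :=
  \row_i [:: - p 0 1; p 0 0; 0; 0]`_i.

(* Rotation of R^3 by the angle a about the line spanned by the unit vector e
   (Rodrigues' formula), extended by the identity on the R factor. *)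
Definition rot3 (e : 'rV[R]_3) (a : R) (v : 'rV[R]_3) : 'rV[R]_3 :=
  cos a *: v + sin a *: cross e v + ((1 - cos a) * dot e v) *: e.

Definition rot4 (e : 'rV[R]_3) (a : R) (p : 'rV[R]_4) : 'rV[R]_4 :=
  pt4 (rot3 e a (r3part p)) (tcoord p).

(* The line spanned by the unit vector e is the z-axis. *)
Definition is_z_axis (e : 'rV[R]_3) : Prop := e = e_z \/ e = - e_z.

End Ambient.

Section Surfaces.
Context {R : realType}.

(* Infinite Frechet differentiability on an open set U: since U is open, the
   values of f and of its derivatives off U play no role. *)
Fixpoint ntimes_differentiable_on (n : nat) (U : set 'rV[R]_2)
    (f : 'rV[R]_2 -> 'rV[R]_4) : Prop :=
  if n is k.+1 then
    (forall q, U q -> differentiable f q) /\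
    (forall v, ntimes_differentiable_on k U ('D_v f))
  else True.

Definition smooth_on (U : set 'rV[R]_2) (f : 'rV[R]_2 -> 'rV[R]_4) : Prop :=
  forall n, ntimes_differentiable_on n U f.

(* x restricted to the open set U is a homeomorphism onto an open subset of M
   in which psi reads as a smooth immersion. *)
Definition local_param (M : topologicalType) (psi : M -> 'rV[R]_4)
    (U : set 'rV[R]_2) (x : 'rV[R]_2 -> M) : Prop :=
  [/\ open U,
      set_inj U x,
      forall q, U q -> {for q, continuous x},
      forall V : set 'rV[R]_2, V `<=` U -> open V -> open (x @` V) &
      smooth_on U (psi \o x) /\
      forall q, U q -> injective ('d (psi \o x) q)].

(* psi : M -> S^2 x R is a connected immersed surface.  The smooth structure of
   M is the one for which psi is an immersion: two local parametrizations as
   above are automatically smoothly compatible, by the inverse function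
   theorem.  Second countability is automatic too (Poincare-Volterra).  An
   embedded surface S is the case where M is S with the subspace topology and
   psi is the inclusion. *)
Definition immersed_surface (M : topologicalType) (psi : M -> 'rV[R]_4) : Prop :=
  [/\ hausdorff_space M,
      connected [set: M],
      forall m, S2xR (psi m) &
      forall m, exists U x, local_param psi U x /\ (x @` U) m].

(* Invariance under the one-parameter group rot4 e.  As psi need not be
   injective, invariance means that the group acts continuously on M compatibly
   with psi; when psi is the inclusion of a subset, Phi is the restriction of
   rot4 e and this says that the subset is invariant. *)
Definition rotational (M : topologicalType) (psi : M -> 'rV[R]_4)
    (e : 'rV[R]_3) : Prop :=
  exists Phi : R -> M -> M,
    [/\ continuous (fun am : R * M => Phi am.1 am.2),
        forall m, Phi 0 m = m,
        forall a b m, Phi (a + b) m = Phi a (Phi b m) &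
        forall a m, psi (Phi a m) = rot4 e a (psi m)].

(* Below, X : U -> S^2 x R is a regular parametrization and q a point of U. *)

Definition partial (i : 'I_2) (X : 'rV[R]_2 -> 'rV[R]_4) : 'rV[R]_2 -> 'rV[R]_4 :=
  'D_(delta_mx 0 i : 'rV[R]_2) X.

(* The normal is taken in S^2 x R: it is also orthogonal to (x, y, z, 0), the
   normal of S^2 x R in R^4. *)
Definition unit_normal (X : 'rV[R]_2 -> 'rV[R]_4) (q : 'rV[R]_2)
    (N : 'rV[R]_4) : Prop :=
  [/\ dot N N = 1,
      dot N (pt4 (r3part (X q)) 0) = 0 &
      forall i, dot N (partial i X q) = 0].

Definition first_form (X : 'rV[R]_2 -> 'rV[R]_4) (q : 'rV[R]_2) : 'M[R]_2 :=
  \matrix_(i, j) dot (partial i X q) (partial j X q).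

(* The covariant derivative of S^2 x R is the projection of that of R^4, and N
   is tangent to S^2 x R, so no curvature term appears. *)
Definition second_form (X : 'rV[R]_2 -> 'rV[R]_4) (q : 'rV[R]_2)
    (N : 'rV[R]_4) : 'M[R]_2 :=
  \matrix_(i, j) dot (partial i (partial j X) q) N.

Definition shape_operator (X : 'rV[R]_2 -> 'rV[R]_4) (q : 'rV[R]_2)
    (N : 'rV[R]_4) : 'M[R]_2 :=
  invmx (first_form X q) *m second_form X q N.

(* k1, k2 are the eigenvalues of the shape operator, with multiplicity. *)
Definition principal_curvatures (X : 'rV[R]_2 -> 'rV[R]_4) (q : 'rV[R]_2)
    (N : 'rV[R]_4) (k1 k2 : R) : Prop :=
  char_poly (shape_operator X q N) = ('X - k1%:P) * ('X - k2%:P).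

Definition is_mean_curvature (X : 'rV[R]_2 -> 'rV[R]_4) (q : 'rV[R]_2)
    (N : 'rV[R]_4) (H : R) : Prop :=
  exists k1 k2, principal_curvatures X q N k1 k2 /\ H = k1 + k2.

(* Replacing N by - N changes the sign of both sides, so no orientation of the
   surface is needed. *)
Definition R_soliton (M : topologicalType) (psi : M -> 'rV[R]_4) : Prop :=
  forall U x, local_param psi U x -> forall q, U q ->
  forall N, unit_normal (psi \o x) q N ->
  is_mean_curvature (psi \o x) q N (dot N (Rfield (psi (x q)))).

Definition minimal_surface (M : topologicalType) (psi : M -> 'rV[R]_4) : Prop :=
  forall U x, local_param psi U x -> forall q, U q ->
  forall N, unit_normal (psi \o x) q N ->
  is_mean_curvature (psi \o x) q N 0.

End Surfaces.

(* Main.v *)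
Require Import Defs.
From HB Require Import structures.
From mathcomp Require Import all_boot all_order all_algebra.
From mathcomp Require Import all_classical all_reals all_analysis.
From mathcomp Require Import ring lra.

(** Write [p = (v, t)] and [N = (n, s)] for a point and a unit normal of the
    surface, with [v] and [n] in R^3, and let [e] be the rotation axis. The
    ambient field is [R = (e_z x v, 0)] and the Killing field of the rotations
    about [e] is [E = (e x v, 0)]. No differential equation for the profile curve
    is needed: the soliton equation is compared with its own translates along an
    orbit.

    Since the surface is invariant, [E] is tangent to it
    ([rotation_field_tangent]), that is, [<n, e x v> = 0].

    If [e] is the z-axis up to sign, then [R] is [E] up to sign, so [<N, R> = 0]
    and being an [R]-soliton is the same as being minimal.

    Otherwise, rotations are isometries, so the mean curvature is constant along
    orbits; by the soliton equation so is [<N, R> = <e_z, v x n>]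
    ([soliton_Rfield_invariant]). Moving along the orbit by the angle [a] replaces
    [c = v x n] by its image under the rotation of angle [a] about [e]. As
    [<e, c> = 0] by tangency of [E], constancy gives [<e_z, c> = 0] and
    [<e_z, e x c> = 0], and these three equations force [c = 0], because [e_z] is
    not a multiple of [e]. With [<n, v> = 0] and [|v| = 1] this gives [n = 0]
    ([soliton_normal_vertical]): the normal is vertical everywhere, the height is
    locally constant, and the connected surface lies in a slice.

    Conversely, a surface in a slice is totally geodesic with vertical normal,
    and [R] is horizontal, so both sides of the soliton equation vanish
    ([slice_soliton]).

    That the slices themselves are connected immersed surfaces is shown with the
    two stereographic charts; they are invariant under rotations about any
    axis. *)

Set Implicit Arguments.
Unset Strict Implicit.
Unset Printing Implicit Defensive.

Import Order.TTheory GRing.Theory Num.Theory.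
Import numFieldNormedType.Exports.

Local Open Scope classical_set_scope.
Local Open Scope ring_scope.

(** * Vector algebra in R^3 and R^4 *)

Section VectorAlgebra.
Context {R : realType}.
Implicit Types (u v w e : 'rV[R]_3) (p n : 'rV[R]_4) (a b : R).

Lemma row3P u v :
  u 0 0 = v 0 0 -> u 0 1 = v 0 1 -> u 0 2 = v 0 2 -> u = v.
Proof.
move=> h0 h1 h2; apply/rowP => -[[|[|[|//]]] i3].
- by rewrite (_ : Ordinal i3 = 0)//; exact/val_inj.
- by rewrite (_ : Ordinal i3 = 1)//; exact/val_inj.
- by rewrite (_ : Ordinal i3 = 2)//; exact/val_inj.
Qed.

Lemma dot3E u v : dot u v = u 0 0 * v 0 0 + u 0 1 * v 0 1 + u 0 2 * v 0 2.
Proof.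
rewrite /dot !big_ord_recl big_ord0 addr0 addrA.
by congr (_ + _ * _ + _ * _); congr (_ _ _); exact/val_inj.
Qed.

Lemma cross0E u v : cross u v 0 0 = u 0 1 * v 0 2 - u 0 2 * v 0 1.
Proof. by rewrite mxE. Qed.

Lemma cross1E u v : cross u v 0 1 = u 0 2 * v 0 0 - u 0 0 * v 0 2.
Proof. by rewrite mxE. Qed.

Lemma cross2E u v : cross u v 0 2 = u 0 0 * v 0 1 - u 0 1 * v 0 0.
Proof. by rewrite mxE. Qed.

Definition crossE := (cross0E, cross1E, cross2E).

Lemma rot3E e a v (i : 'I_3) :
  rot3 e a v 0 i = cos a * v 0 i + sin a * cross e v 0 i
                   + (1 - cos a) * dot e v * e 0 i.
Proof. by rewrite /rot3 !mxE. Qed.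

Lemma ez0 : (e_z : 'rV[R]_3) 0 0 = 0. Proof. by rewrite mxE. Qed.
Lemma ez1 : (e_z : 'rV[R]_3) 0 1 = 0. Proof. by rewrite mxE. Qed.
Lemma ez2 : (e_z : 'rV[R]_3) 0 2 = 1. Proof. by rewrite mxE. Qed.
Definition ezE := (ez0, ez1, ez2).

Lemma r3partE p (i : 'I_3) : r3part p 0 i = p 0 (lshift 1 i).
Proof. by rewrite mxE. Qed.

Lemma r3part0 p : r3part p 0 0 = p 0 0.
Proof. by rewrite r3partE; congr (p _ _); exact/val_inj. Qed.
Lemma r3part1 p : r3part p 0 1 = p 0 1.
Proof. by rewrite r3partE; congr (p _ _); exact/val_inj. Qed.
Lemma r3part2 p : r3part p 0 2 = p 0 2.
Proof. by rewrite r3partE; congr (p _ _); exact/val_inj. Qed.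

Lemma dot4E p n : dot p n = dot (r3part p) (r3part n) + tcoord p * tcoord n.
Proof.
rewrite dot3E !r3part0 !r3part1 !r3part2 /tcoord /dot !big_ord_recl big_ord0.
rewrite addr0 !addrA.
by congr (_ + _ * _ + _ * _ + _ * _); congr (_ _ _); exact/val_inj.
Qed.

Lemma r3part_pt4 v a : r3part (pt4 v a) = v.
Proof. exact: row_mxKl. Qed.

Lemma tcoord_pt4 v a : tcoord (pt4 v a) = a.
Proof.
rewrite /tcoord.
have -> : pt4 v a 0 3 = pt4 v a 0 (@rshift 3 1 0) by congr (pt4 _ _ _ _); exact/val_inj.
by apply: etrans (@row_mxEr R 1 3 1 v (const_mx a) 0 0) _; rewrite mxE.
Qed.

Lemma pt4_eta p : pt4 (r3part p) (tcoord p) = p.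
Proof.
apply: etrans (@hsubmxK R 1 3 1 p); congr (@row_mx R 1 3 1 _ _).
apply/rowP => i; rewrite !mxE /tcoord; congr (p _ _).
by rewrite (ord1 i); exact/val_inj.
Qed.

Lemma row4P p n : r3part p = r3part n -> tcoord p = tcoord n -> p = n.
Proof. by move=> h1 h2; rewrite -(pt4_eta p) h1 h2 pt4_eta. Qed.

Lemma RfieldE p : Rfield p = pt4 (cross e_z (r3part p)) 0.
Proof.
apply: row4P; rewrite ?r3part_pt4 ?tcoord_pt4; last by rewrite /tcoord mxE.
apply: row3P; rewrite ?r3part0 ?r3part1 ?r3part2 !crossE !ezE mxE /=.
- by rewrite r3part1; ring.
- by rewrite r3part0; ring.
- by ring.
Qed.

Lemma dotC m (u v : 'rV[R]_m) : dot u v = dot v u.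
Proof. by apply: eq_bigr => i _; rewrite mulrC. Qed.

Lemma dot_is_linear m (u : 'rV[R]_m) : linear (dot u).
Proof.
move=> k v w; rewrite /dot /= scaler_sumr -big_split /=.
by apply: eq_bigr => i _; rewrite !mxE /GRing.scale /=; ring.
Qed.

HB.instance Definition _ m (u : 'rV[R]_m) :=
  GRing.isLinear.Build R 'rV[R]_m R _ (dot u) (dot_is_linear u).

Lemma dot_eq0 m (u : 'rV[R]_m) : dot u u = 0 -> u = 0.
Proof.
move=> /eqP; rewrite /dot psumr_eq0 => [/allP h|i _]; last first.
  by rewrite -expr2 sqr_ge0.
apply/rowP => i; have := h i; rewrite mem_index_enum => /(_ isT) /=.
by rewrite mulf_eq0 orbb mxE => /eqP.
Qed.

(** Moves the ambient rotation field off the normal: [<n, e x v> = <e, v x n>]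
    turns statements on [<N, R>] into statements on the single vector [v x n]. *)
Lemma triple_cycl u v w : dot u (cross v w) = dot v (cross w u).
Proof. by rewrite !dot3E !crossE; ring. Qed.

(** The three algebraic laws of Rodrigues' formula hold only modulo [|e|^2 = 1]
    and [cos^2 + sin^2 = 1]; each proof displays the defect as an explicit
    combination of these two relations. *)
Lemma rot3_dot e a u v : dot e e = 1 -> dot (rot3 e a u) (rot3 e a v) = dot u v.
Proof.
move=> ee; have cs := cos2Dsin2 a.
have : dot (rot3 e a u) (rot3 e a v) - dot u v =
  (dot e e - 1) * ((sin a) ^+ 2 * dot u v
                   + (1 - cos a) ^+ 2 * (dot e u * dot e v))
  + ((cos a) ^+ 2 + (sin a) ^+ 2 - 1) * (dot u v - dot e u * dot e v).
  rewrite [dot (rot3 _ _ _) _]dot3E !rot3E !crossE !dot3E.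
  by move: (cos a) (sin a) => c s; ring.
by rewrite ee cs !subrr !mul0r addr0 => /eqP; rewrite subr_eq0 => /eqP.
Qed.

Lemma rot3_cross e a u v : dot e e = 1 ->
  cross (rot3 e a u) (rot3 e a v) = rot3 e a (cross u v).
Proof.
move=> ee; have cs := cos2Dsin2 a; apply/eqP; rewrite -subr_eq0; apply/eqP.
pose w := cross u v.
have -> : cross (rot3 e a u) (rot3 e a v) - rot3 e a w =
  (dot e e - 1) *: ((cos a * (1 - cos a)) *: w
                   + (sin a * (1 - cos a)) *: cross e w)
  + ((cos a) ^+ 2 + (sin a) ^+ 2 - 1) *: (dot e w *: e).
  have rE := rot3E e a; move: {ee cs} (cos a) (sin a) rE => c s rE.
  apply: row3P; rewrite [LHS]mxE [X in _ + X]mxE crossE !rE /w !dot3E;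
  by rewrite !mxE /=; ring.
by rewrite ee cs !subrr !scale0r addr0.
Qed.

Lemma rot3_addA e a b v : dot e e = 1 ->
  rot3 e (a + b) v = rot3 e a (rot3 e b v).
Proof.
move=> ee; apply/esym/eqP; rewrite -subr_eq0; apply/eqP.
have -> : rot3 e a (rot3 e b v) - rot3 e (a + b) v =
  (dot e e - 1) *: (- (sin a * sin b) *: v
    + ((1 - cos a) * (1 - cos b) * dot e v) *: e).
  apply: row3P; rewrite [LHS]mxE [X in _ + X]mxE !rot3E cosD sinD !crossE;
  have rE := @rot3E e b v;
  move: {ee} (cos a) (sin a) (cos b) (sin b) rE => c s c' s' rE;
  by rewrite !dot3E !rE !mxE /= !dot3E; ring.
by rewrite ee subrr scale0r.
Qed.

Lemma rot3_0 e v : rot3 e 0 v = v.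
Proof.
by rewrite /rot3 cos0 sin0 subrr mul0r !scale0r !addr0 scale1r.
Qed.

End VectorAlgebra.

(** * Linear maps and differentiability *)

Section LinearMaps.
Context {R : realType}.

Lemma cvg_rV (T : Type) (F : set_system T) {FF : Filter F} n
    (f : T -> 'rV[R]_n) (l : 'rV[R]_n) :
  (forall j, f x 0 j @[x --> F] --> l 0 j) -> f x @[x --> F] --> l.
Proof.
move=> fl A [P Pl PA].
have FP : \forall x \near F, forall j, P 0 j (f x 0 j).
  by apply: filter_forall => j; exact: (fl j _ (Pl 0 j)).
by apply: filterS FP => y Py; apply: PA => i j; rewrite (ord1 i).
Qed.

Lemma row_linear_continuous n (W : normedModType R)
  (L : {linear 'rV[R]_n -> W}) : continuous L.
Proof.
have -> : L = (fun u => \sum_(j < n) u 0 j *: L (delta_mx 0 j)) :> (_ -> _).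
  apply/funext => u; rewrite [in LHS](row_sum_delta u) linear_sum.
  by apply: eq_bigr => j _; rewrite linearZ.
apply: (@continuous_big _ _ +%R 0 xpredT add_continuous) => j _ u.
by apply: (@cvgZr_tmp _ _ _ (nbhs u) _ (fun v => v 0 j)); apply: coord_continuous.
Qed.

Lemma is_derive_linear (V W W' : normedModType R) (L : {linear W -> W'})
    (f : V -> W) q v :
  continuous L -> derivable f q v -> is_derive q v (L \o f) (L ('D_v f q)).
Proof.
move=> Lc fd.
have h : h^-1 *: ((L \o f) (h *: v + q) - (L \o f) q) @[h --> 0^'] --> L ('D_v f q).
  rewrite (_ : (fun h => _) =
    L \o (fun h => h^-1 *: (f (h *: v + q) - f q))); last first.
    by apply/funext => h /=; rewrite linearZZ (linearB L).
  exact: (@cvg_comp _ _ _ _ _ _ _ _ fd (Lc _)).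
by split; [apply/cvg_ex; exists (L ('D_v f q))|apply/cvg_lim].
Qed.

Lemma differentiable_rV (V : normedModType R) n (f : V -> 'rV[R]_n) q :
  (forall j, differentiable (fun x => f x 0 j) q) -> differentiable f q.
Proof.
move=> fd.
have -> : f = \sum_(j < n) (fun x => f x 0 j *: (delta_mx 0 j : 'rV[R]_n)).
  by apply/funext => x; rewrite fct_sumE [LHS]row_sum_delta.
by apply: differentiable_sum => j; apply: differentiableZl.
Qed.

Lemma near_open (T : topologicalType) (U : set T) (P : T -> Prop) q :
  open U -> U q -> (forall y, U y -> P y) -> \forall y \near q, P y.
Proof. by move=> oU Uq UP; apply: filterS UP _; exact: open_nbhs_nbhs. Qed.

Lemma differentiable_eps (V W : normedModType R) (f : V -> W) q (k : R) :
  differentiable f q -> 0 < k ->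
  \forall h \near (0 : V), `|f (h + q) - f q - 'd f q h| <= k * `|h|.
Proof.
move=> /diff_locally /eqaddoP fo k0; apply: filterS (fo _ k0) => h /=.
by rewrite /cst /= !fctE /= opprD addrA.
Qed.

(** Frechet differentiability is local: a map that agrees near [q] with a
    differentiable one satisfies the same first-order expansion there. *)
Lemma near_eq_differentiable (V W : normedModType R) (f g : V -> W) q :
  (\forall y \near q, f y = g y) -> differentiable f q ->
  differentiable g q /\ 'd g q = 'd f q :> (V -> W).
Proof.
move=> fg df.
have gE : g \o shift q = cst (g q) + 'd f q +o_ 0 id.
  apply/eqaddoP => k k0.
  have fg0 : \forall h \near (0 : V), f (h + q) = g (h + q).
    by move: fg; rewrite (near_shift 0) /= subr0.
  near=> h.
  have -> : (g \o shift q - (cst (g q) + 'd f q)) h =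
      f (h + q) - f q - 'd f q h.
    rewrite !fctE /= /cst opprD addrA -(nbhs_singleton fg).
    by congr (_ - _ - _); apply/esym; near: h.
  by near: h; exact: differentiable_eps.
have dE := diff_unique (diff_continuous df) gE.
by split => //; apply/diff_locallyP; rewrite dE; split=> //; exact: diff_continuous.
Unshelve. all: by end_near. Qed.

End LinearMaps.

(** * Rotations about an axis, and smooth maps *)

Section Rotations.
Context {R : realType}.
Implicit Types (u v e : 'rV[R]_3) (p n : 'rV[R]_4) (a b : R).

Lemma r3partP a p n : r3part (a *: p + n) = a *: r3part p + r3part n.
Proof. by apply/rowP => i; rewrite !mxE. Qed.

Lemma tcoordP a p n : tcoord (a *: p + n) = a * tcoord p + tcoord n.
Proof. by rewrite /tcoord !mxE. Qed.

Lemma r3part_rot4 e a p : r3part (rot4 e a p) = rot3 e a (r3part p).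
Proof. exact: r3part_pt4. Qed.

Lemma tcoord_rot4 e a p : tcoord (rot4 e a p) = tcoord p.
Proof. exact: tcoord_pt4. Qed.

Lemma rot4_is_linear e a : linear (rot4 e a).
Proof.
move=> k p n; apply: row4P.
  rewrite r3partP !r3part_rot4 r3partP; apply/rowP => i.
  by rewrite !(rot3E, mxE) !dot3E; case: i => -[|[|[|//]]] ? /=; rewrite !mxE; ring.
by rewrite tcoordP !tcoord_rot4 tcoordP.
Qed.

HB.instance Definition _ e a :=
  GRing.isLinear.Build R 'rV[R]_4 'rV[R]_4 _ (rot4 e a) (rot4_is_linear e a).

Lemma rot4_dot e a p n : dot e e = 1 -> dot (rot4 e a p) (rot4 e a n) = dot p n.
Proof.
by move=> ee; rewrite !dot4E !r3part_rot4 !tcoord_rot4 rot3_dot.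
Qed.

Lemma rot4_0 e p : rot4 e 0 p = p.
Proof. by rewrite /rot4 rot3_0 pt4_eta. Qed.

Lemma rot4_addA e a b p : dot e e = 1 ->
  rot4 e (a + b) p = rot4 e a (rot4 e b p).
Proof.
by move=> ee; rewrite /rot4 r3part_pt4 tcoord_pt4 rot3_addA.
Qed.

Lemma rot4_inj e a : dot e e = 1 -> injective (rot4 e a).
Proof.
move=> ee p n h; rewrite -(rot4_0 e p) -(rot4_0 e n) -(addNr a).
by rewrite !rot4_addA// h.
Qed.

Lemma pt4P a b c u v : pt4 (a *: u + v) (a * b + c) = a *: pt4 u b + pt4 v c.
Proof.
by apply: row4P; rewrite ?(r3partP, tcoordP) ?(r3part_pt4, tcoord_pt4).
Qed.

Lemma is_derive_scalel (W : normedModType R) (k : R -> R) (w : W) (x dk : R) :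
  is_derive x 1 k dk -> is_derive x 1 (fun a => k a *: w) (dk *: w).
Proof.
move=> [kd <-].
have h : t^-1 *: (k (t *: 1 + x) *: w - k x *: w) @[t --> 0^'] -->
    'D_1 k x *: w.
  rewrite (_ : (fun t => _) =
    (fun t => (t^-1 *: (k (t *: 1 + x) - k x)) *: w)); last first.
    by apply/funext => t; rewrite -scalerBl scalerA.
  exact: cvgZr_tmp kd.
by split; [apply/cvg_ex; exists ('D_1 k x *: w)|apply/cvg_lim].
Qed.

(** The Killing field of the rotations about [e] is [p |-> (e x v, 0)]. *)
Lemma is_derive_rot4 e p :
  is_derive (0 : R) 1 (fun a => rot4 e a p) (pt4 (cross e (r3part p)) 0).
Proof.
pose v := r3part p; pose w := dot e v *: e.
pose A := pt4 (v - w) 0; pose B := pt4 (cross e v) 0; pose C := pt4 w (tcoord p).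
rewrite (_ : (fun a => _) =
  (fun a => cos a *: A) + ((fun a => sin a *: B) + cst C)); last first.
  apply/funext => a; rewrite !fctE /= /cst /A /B /C -!pt4P !mulr0 !add0r.
  rewrite /rot4; congr pt4; rewrite /rot3 -/v -scalerA -/w.
  by rewrite scalerBl scalerBr scale1r [RHS]addrACA [_ + w]addrC.
have dA := is_derive_scalel A (is_derive_cos 0).
have dB := is_derive_scalel B (is_derive_sin 0).
have dC := is_derive_cst C (0 : R) 1.
apply: is_derive_eq (is_deriveD dA (is_deriveD dB dC)) _.
by rewrite sin0 cos0 oppr0 scale0r add0r addr0 scale1r.
Qed.

End Rotations.

Section Smooth.
Context {R : realType}.
Implicit Types (X : 'rV[R]_2 -> 'rV[R]_4) (U : set 'rV[R]_2).

Lemma smooth_differentiable U X q : smooth_on U X -> U q -> differentiable X q.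
Proof. by move=> /(_ 1%N) [h _] Uq; exact: h. Qed.

Lemma smooth_partial_differentiable U X v q :
  smooth_on U X -> U q -> differentiable ('D_v X) q.
Proof. by move=> /(_ 2%N) [_ /(_ v) [h _]] Uq; exact: h. Qed.

Lemma derive_row_linear (W : normedModType R) X v q (L : {linear 'rV[R]_4 -> W}) :
  differentiable X q -> 'D_v (L \o X) q = L ('D_v X q).
Proof.
move=> dX.
have := is_derive_linear (@row_linear_continuous _ _ _ L)
  (@diff_derivable _ _ _ X q v dX).
by move=> /@derive_val.
Qed.

(** [Y] is only asked to agree with [L \o X] on [U], since the induction passes
    to directional derivatives, which commute with [L] on [U] only. *)
Lemma ntimes_differentiable_linear (L : {linear 'rV[R]_4 -> 'rV[R]_4}) U n X Y :
  open U -> (forall q, U q -> Y q = L (X q)) ->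
  ntimes_differentiable_on n U X -> ntimes_differentiable_on n U Y.
Proof.
move=> oU; elim: n X Y => //= n IH X Y YE [dX DX].
have YEn q : U q -> \forall y \near q, L (X y) = Y y.
  by move=> Uq; apply: near_open oU Uq _ => y Uy; rewrite YE.
have dLX q : U q -> differentiable (L \o X) q.
  move=> Uq; apply: differentiable_comp; first exact: dX.
  exact/linear_differentiable/row_linear_continuous.
split=> [q Uq|v]; first by have [] := near_eq_differentiable (YEn q Uq) (dLX q Uq).
apply: IH (DX v) => q Uq; rewrite -(derive_row_linear _ _ (dX q Uq)).
by apply: near_eq_derive; apply: filterS (YEn q Uq) => y.
Qed.

End Smooth.

(** * Normals and velocities of curves in the surface *)

Section LocalGeometry.
Context {R : realType}.
Implicit Types (X : 'rV[R]_2 -> 'rV[R]_4) (U : set 'rV[R]_2) (q h : 'rV[R]_2)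
  (N w : 'rV[R]_4).

Lemma derive_partials X q h : differentiable X q ->
  'D_h X q = \sum_(i < 2) h 0 i *: partial i X q.
Proof.
move=> dX; rewrite deriveE// [in LHS](row_sum_delta h) linear_sum.
by apply: eq_bigr => i _; rewrite linearZ /partial deriveE.
Qed.

Lemma dot_derive0 X q N h : differentiable X q ->
  (forall i, dot N (partial i X q) = 0) -> dot N ('D_h X q) = 0.
Proof.
move=> dX N0; rewrite derive_partials// linear_sum big1// => i _.
by rewrite linearZZ /= N0 scaler0.
Qed.

(** In finite dimension an injective linear map has a linear, hence bounded,
    left inverse. *)
Lemma injective_bounded_below m n (J : {linear 'rV[R]_m -> 'rV[R]_n}) :
  injective J -> exists2 k : R, 0 < k & forall h : 'rV[R]_m, `|h| <= k * `|J h|.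
Proof.
move=> Ji; pose A := lin1_mx J.
have freeA : row_free A.
  apply/row_freeP; exists (pinvmx A); apply: mulmxVp.
  by apply: inj_row_free => v vA; apply: Ji; rewrite linear0 -vA mul_rV_lin1.
have [k k0 kP] := linear_lipschitz
  (@row_linear_continuous R n _ (mulmxr (pinvmx A) : {linear 'rV[R]_n -> 'rV[R]_m})).
exists k => // h; apply: le_trans (kP (J h)); rewrite /=.
by rewrite -mul_rV_lin1 -mulmxA mulmxVp ?mulmx1.
Qed.

(** The velocity of a curve in the surface is tangent to it, even though the
    curve is only known to be continuous in the chart: as the differential of
    the parametrization is bounded below, [psi] moves at least as fast as the
    chart coordinates. *)
Lemma normal_orth_velocity (M : topologicalType) (psi : M -> 'rV[R]_4)
    U (x : 'rV[R]_2 -> M) q N (c : R -> M) w :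
  local_param psi U x -> U q -> c 0 = x q -> {for 0, continuous c} ->
  is_derive (0 : R) 1 (psi \o c) w ->
  (forall i, dot N (partial i (psi \o x) q) = 0) -> dot N w = 0.
Proof.
move=> [oU injx _ openx [smx dinj]] Uq c0 cc [dpsi wE] N0.
set X := psi \o x.
have dX : differentiable X q by exact: smooth_differentiable smx Uq.
have [k k0 kP] := injective_bounded_below (dinj q Uq).
have [C C0 CP] := linear_lipschitz (@row_linear_continuous R 4 _ (dot N : {linear _ -> _})).
pose Q (a : R) : 'rV[R]_4 := a^-1 *: (psi (c a) - psi (c 0)).
have Qw : Q a @[a --> 0^'] --> w.
  rewrite -wE; move: dpsi; rewrite /derivable /derive /Q.
  by under eq_fun do rewrite /= scaler1 addr0.
suff small (ep : R) : 0 < ep -> `|dot N w| <= ep * `|w|.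
  apply/eqP; rewrite -normr_le0; apply/ler_addgt0Pr => ep ep0; rewrite add0r.
  have w1 : 0 < `|w| + 1 by rewrite ltr_wpDl.
  apply: le_trans (small (ep / (`|w| + 1)) _) _; first exact: divr_gt0.
  by rewrite mulrAC ler_pdivrMr// ler_pM2l// lerDl.
move=> ep0.
(* The first bound makes the remainder of the expansion at most half of [h],
   so that [|h| <= 2 k |D|]; the second turns [C ep' |h|] into [ep |D|]. *)
pose ep' := Num.min (2 * k)^-1 (ep / (2 * C * k)).
have ep'0 : 0 < ep'.
  by rewrite lt_min invr_gt0 divr_gt0 ?mulr_gt0.
have ep'k : k * ep' <= 2^-1.
  rewrite -ler_pdivlMl//; apply: le_trans (_ : (2 * k)^-1 <= _).
    by rewrite ge_min lexx.
  by rewrite invfM mulrC.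
have ep'C : C * (ep' * (2 * k)) <= ep.
  have : ep' <= ep / (2 * C * k) by rewrite ge_min lexx orbT.
  rewrite ler_pdivlMr ?mulr_gt0//.
  by rewrite (_ : ep' * (2 * C * k) = C * (ep' * (2 * k)))//; ring.
have near_c : \forall a \near (0 : R),
    `|dot N (psi (c a) - psi (c 0))| <= ep * `|psi (c a) - psi (c 0)|.
  have := differentiable_eps dX ep'0; rewrite (near_shift q 0) sub0r => nq.
  pose S := U `&` [set y | `|X y - X q - 'd X q (y - q)| <= ep' * `|y - q|].
  have Sq : S° q.
    apply: filterI; first exact: open_nbhs_nbhs.
    by apply: filterS nq => y /=; rewrite subrK.
  have xO : nbhs (c 0) (x @` S°).
    apply: open_nbhs_nbhs; split; last by exists q.
    by apply: openx => [y /interior_subset[]//|]; exact: open_interior.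
  have cS : \forall a \near (0 : R), (x @` S°) (c a) := cc _ xO.
  apply: filterS cS => a [y /interior_subset[Uy /= yP] yca].
  rewrite -yca c0 -[psi (x y)]/(X y) -[psi (x q)]/(X q).
  set D := X y - X q in yP *; set h := y - q in yP *.
  (* [N] kills the linear part of [D], so only the remainder counts. *)
  have NJ : dot N ('d X q h) = 0 by rewrite -deriveE// dot_derive0.
  have hD : `|h| <= 2 * k * `|D|.
    have := kP h.
    have : `|'d X q h| <= `|D| + ep' * `|h|.
      rewrite -[X in `|X|](subrK D) addrC; apply: le_trans (ler_normD _ _) _.
      by rewrite lerD2l distrC.
    rewrite -(ler_pM2l k0) mulrDr mulrA => le1 le2.
    have le3 := ler_wpM2r (normr_ge0 h) ep'k.
    lra.
  rewrite -[dot N D]subr0 -NJ -linearB /=.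
  apply: le_trans (CP _) _.
  apply: le_trans (ler_wpM2l (ltW C0) yP) _.
  apply: le_trans (_ : C * (ep' * (2 * k * `|D|)) <= _).
    by rewrite ler_pM2l// ler_pM2l.
  rewrite [leLHS](_ : _ = C * (ep' * (2 * k)) * `|D|); last by ring.
  exact: ler_wpM2r.
have h1 : `|dot N (Q a)| @[a --> 0^'] --> `|dot N w|.
  have dN : dot N v @[v --> w] --> dot N w.
    exact: (@row_linear_continuous R 4 _ (dot N : {linear _ -> _})).
  by apply: cvg_norm; exact: cvg_comp Qw dN.
have h2 : ep * `|Q a| @[a --> 0^'] --> ep * `|w|.
  exact: cvgM (cvg_cst ep) (cvg_norm Qw).
apply: ler_cvg_to h1 h2 _; apply: cvg_within.
apply: filterS near_c => a ha.
rewrite /Q linearZZ !normrZ mulrCA.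
by apply: ler_wpM2l.
Qed.

End LocalGeometry.

(** * Curvature and ambient isometries *)

Section Symmetry.
Context {R : realType}.
Implicit Types (X : 'rV[R]_2 -> 'rV[R]_4) (U : set 'rV[R]_2) (q h : 'rV[R]_2)
  (N w : 'rV[R]_4) (e : 'rV[R]_3).

(** A homeomorphism of [M] over an ambient linear injection carries
    parametrizations to parametrizations, so a soliton equation may be compared
    with its translate along the action. *)
Lemma local_param_symmetry (M : topologicalType) (psi : M -> 'rV[R]_4)
    (F G : M -> M) (L : {linear 'rV[R]_4 -> 'rV[R]_4}) U (x : 'rV[R]_2 -> M) :
  continuous F -> continuous G -> cancel F G -> cancel G F ->
  injective L -> (forall m, psi (F m) = L (psi m)) ->
  local_param psi U x -> local_param psi U (F \o x).
Proof.
move=> cF cG FG GF Li psiF [oU injx cx openx [smx dinj]].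
have psiE : psi \o (F \o x) = L \o (psi \o x) by apply/funext => q /=.
split.
- exact: oU.
- move=> y z Uy Uz /(congr1 G) /=; rewrite !FG; exact: injx.
- move=> q Uq; apply: continuous_comp; [exact: cx|exact: cF].
- move=> V VU oV.
  have -> : (F \o x) @` V = G @^-1` (x @` V).
    apply/seteqP; split=> m.
      by case=> y Vy <- /=; exists y => //; rewrite FG.
    by case=> y Vy xy; exists y => //=; rewrite xy GF.
  by apply: open_comp => [m _|]; [exact: cG|exact: openx].
- rewrite psiE; split=> [n|q Uq].
    by apply: (ntimes_differentiable_linear (L := L) oU _ (smx n)) => q Uq.
  have dX : differentiable (psi \o x) q by exact: smooth_differentiable smx Uq.
  have dL : differentiable L ((psi \o x) q).
    exact/linear_differentiable/row_linear_continuous.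
  rewrite (diff_comp dX dL) => y z /=.
  rewrite diff_lin; last exact: row_linear_continuous.
  by move=> /Li; exact: dinj.
Qed.

Section Isometry.
Variables (L : {linear 'rV[R]_4 -> 'rV[R]_4}) (U : set 'rV[R]_2)
  (X : 'rV[R]_2 -> 'rV[R]_4).
Hypotheses (Ldot : forall p n, dot (L p) (L n) = dot p n) (oU : open U)
  (smX : smooth_on U X).

Lemma partial_linear i q : U q -> partial i (L \o X) q = L (partial i X q).
Proof. by move=> Uq; apply: derive_row_linear; exact: smooth_differentiable smX Uq. Qed.

Lemma partial2_linear i j q : U q ->
  partial i (partial j (L \o X)) q = L (partial i (partial j X) q).
Proof.
move=> Uq; rewrite -[RHS]derive_row_linear; last first.
  exact: smooth_partial_differentiable smX Uq.
by apply: near_eq_derive; apply: near_open oU Uq _ => y /partial_linear ->.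
Qed.

Lemma shape_operator_isometry q N : U q ->
  shape_operator (L \o X) q (L N) = shape_operator X q N.
Proof.
move=> Uq.
have IE : first_form (L \o X) q = first_form X q.
  by apply/matrixP => i j; rewrite !mxE !partial_linear// Ldot.
have IIE : second_form (L \o X) q (L N) = second_form X q N.
  by apply/matrixP => i j; rewrite !mxE partial2_linear// Ldot.
by rewrite /shape_operator IE IIE.
Qed.

End Isometry.

Lemma unit_normal_rot4 e a U X q N : dot e e = 1 -> open U -> smooth_on U X ->
  U q -> unit_normal X q N -> unit_normal (rot4 e a \o X) q (rot4 e a N).
Proof.
move=> ee oU smX Uq [NN NX NT]; split=> [||i].
- by rewrite rot4_dot.
- have -> : pt4 (r3part ((rot4 e a \o X) q)) 0 =
            rot4 e a (pt4 (r3part (X q)) 0).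
    by rewrite /= r3part_rot4 /rot4 r3part_pt4 tcoord_pt4.
  by rewrite rot4_dot.
- by rewrite (partial_linear (rot4 e a) smX)// rot4_dot.
Qed.

(** The sum of the principal curvatures is read off the characteristic
    polynomial, as minus its coefficient of degree 1. *)
Lemma mean_curvature_unique X Y q q' N N' (H H' : R) :
  shape_operator X q N = shape_operator Y q' N' ->
  is_mean_curvature X q N H -> is_mean_curvature Y q' N' H' -> H = H'.
Proof.
rewrite /is_mean_curvature /principal_curvatures.
move=> -> [k1 [k2 [-> ->]]] [l1 [l2 [+ ->]]].
have mE (a b : R) : (('X - a%:P) * ('X - b%:P))`_1 = - (a + b).
  rewrite mulrBl mulrBr !coefB coefXM coefCM coefMC !coefX /= !coefB !coefX !coefC /=.
  by ring.
by move=> /(congr1 (fun p : {poly R} => p`_1)); rewrite !mE => /oppr_inj.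
Qed.

(** Three vectors of a 4-dimensional space have a common nonzero orthogonal:
    the 4 x 3 matrix with these columns has a left kernel. *)
Lemma exists_unit_normal X q : exists N, unit_normal X q N.
Proof.
pose K : 'M[R]_(4, 3) := \matrix_(i, j)
  [:: pt4 (r3part (X q)) 0 0 i; partial 0 X q 0 i; partial 1 X q 0 i]`_j.
have kK : kermx K != 0.
  rewrite -mxrank_eq0 mxrank_ker -lt0n subn_gt0.
  exact: leq_ltn_trans (rank_leq_col K) _.
pose n := nz_row (kermx K).
have n0 : n != 0 by rewrite nz_row_eq0.
have nK : n *m K = 0 by apply/sub_kermxP; exact: nz_row_sub.
have nK0 (j : 'I_3) : \sum_i n 0 i * K i j = 0.
  by have := congr1 (fun A : 'rV[R]_3 => A 0 j) nK; rewrite !mxE.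
pose r := Num.sqrt (dot n n).
have nn0 : 0 < dot n n.
  rewrite lt_def; apply/andP; split; first by apply: contra n0 => /eqP/dot_eq0 ->.
  by apply: sumr_ge0 => i _; rewrite -expr2 sqr_ge0.
have r0 : r != 0 by rewrite gt_eqF// sqrtr_gt0.
have rr : r ^+ 2 = dot n n by rewrite sqr_sqrtr// ltW.
exists (r^-1 *: n).
have dn m : dot n m = 0 -> dot (r^-1 *: n) m = 0.
  by move=> nm; rewrite dotC linearZZ /= dotC nm scaler0.
split.
- by rewrite linearZZ /= dotC linearZZ /= -rr /GRing.scale /= expr2 mulKf// mulVf.
- apply: dn; rewrite -[RHS](nK0 0); apply: eq_bigr => i _; by rewrite !mxE.
- move=> i; apply: dn; case: i => -[|[|//]] i2.
    rewrite (_ : Ordinal i2 = 0); last exact/val_inj.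
    by rewrite -[RHS](nK0 1); apply: eq_bigr => i _; rewrite !mxE.
  rewrite (_ : Ordinal i2 = 1); last exact/val_inj.
  by rewrite -[RHS](nK0 2); apply: eq_bigr => i _; rewrite !mxE.
Qed.

End Symmetry.

(** * Surfaces contained in a slice *)

Section LocallyConstant.
Context {R : realType}.

(** Mean value theorem along the segments of a ball. *)
Lemma derive0_locally_constant n (f : 'rV[R]_n -> R) (U : set 'rV[R]_n) q :
  open U -> U q ->
  (forall y, U y -> differentiable f y /\ forall h, 'D_h f y = 0) ->
  \forall y \near q, f y = f q.
Proof.
move=> oU Uq Uf; have : nbhs q U by exact: open_nbhs_nbhs.
move=> /nbhs_ballP [r r0 rU]; apply/nbhs_ballP; exists r => // y qy.
pose h := y - q; pose g (s : R) := f (s *: h + q).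
have segU (s : R) : 0 <= s <= 1 -> U (s *: h + q).
  move=> /andP[s0 s1]; apply: rU; move: qy; rewrite -!ball_normE /= => qy.
  rewrite opprD addrCA subrr addr0 normrN normrZ ger0_norm//.
  by apply: le_lt_trans qy; rewrite distrC -[leRHS]mul1r ler_wpM2r.
have dg (s : R) : 0 <= s <= 1 -> is_derive s 1 g 0.
  move=> s01; have [df Df] := Uf _ (segU s s01).
  have dfh : derivable f (s *: h + q) h by exact: diff_derivable.
  have gE : (fun t : R => t^-1 *: (g (t *: 1 + s) - g s)) =
      (fun t => t^-1 *: (f (t *: h + (s *: h + q)) - f (s *: h + q))).
    apply/funext => t; congr (_ *: (_ - _)); rewrite /g.
    by rewrite [t *: 1]mulr1 scalerDl addrA.
  by split; rewrite /derivable /derive gE// -[RHS](Df h).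
have [||c _ /eqP] := @MVT R g (fun=> 0) 0 1 ltr01.
- by move=> s /[!in_itv] /andP[/ltW s0 /ltW s1]; apply: dg; rewrite s0 s1.
- apply: derivable_within_continuous => s; rewrite in_itv => /dg.
  by case.
rewrite mul0r subr_eq0 /g scale1r scale0r add0r subrK => /eqP.
by [].
Qed.

Lemma locally_constant_connected (M : topologicalType) (T : Type) (f : M -> T) :
  connected [set: M] -> (forall m, \forall m' \near m, f m' = f m) ->
  forall m m', f m = f m'.
Proof.
move=> cM fM m m'.
have opred (P : T -> Prop) : open (f @^-1` P).
  rewrite openE => y Py; apply: filterS (fM y) => z /= fzy.
  by rewrite /preimage /= fzy.
have : f @^-1` [set f m'] = [set: M].
  apply: cM; first by exists m'.
  - by exists (f @^-1` [set f m']); rewrite ?setTI//; exact: opred.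
  - exists (f @^-1` [set f m']); last by rewrite setTI.
    by rewrite -[X in closed X]setCK; apply: open_closedC; exact: (opred (~` [set f m'])).
by move=> /seteqP [_ /(_ m)]; apply.
Qed.

End LocallyConstant.

Section Slices.
Context {R : realType}.
Implicit Types (X : 'rV[R]_2 -> 'rV[R]_4) (U : set 'rV[R]_2) (q h : 'rV[R]_2)
  (N w : 'rV[R]_4) (e : 'rV[R]_3).

Lemma tcoord_is_linear : linear (tcoord : 'rV[R]_4 -> R).
Proof. exact: tcoordP. Qed.

HB.instance Definition _ :=
  GRing.isLinear.Build R 'rV[R]_4 R _ tcoord tcoord_is_linear.

Lemma derive_tcoord X q h : differentiable X q ->
  'D_h (tcoord \o X) q = tcoord ('D_h X q).
Proof. by move=> dX; apply: derive_row_linear. Qed.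

Lemma locally_constant_tcoord (M : topologicalType) (psi : M -> 'rV[R]_4) :
  (forall m, exists U x, local_param psi U x /\ (x @` U) m) ->
  (forall U x, local_param psi U x -> forall q, U q ->
    forall i, tcoord (partial i (psi \o x) q) = 0) ->
  forall m, \forall m' \near m, tcoord (psi m') = tcoord (psi m).
Proof.
move=> charts D0 m; have [U [x [px [q Uq <-]]]] := charts m.
have [oU _ _ openx [smx _]] := px; set X := psi \o x.
have nq : \forall y \near q, tcoord (X y) = tcoord (X q).
  apply: (derive0_locally_constant (f := tcoord \o X) oU Uq) => y Uy.
  have dX : differentiable X y by exact: smooth_differentiable smx Uy.
  split=> [|h].
    apply: differentiable_comp => //.
    exact/linear_differentiable/row_linear_continuous.
  rewrite derive_tcoord// derive_partials// linear_sum big1// => i _.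
  by rewrite linearZZ /= (D0 _ _ px)// scaler0.
pose S := U `&` [set y | tcoord (X y) = tcoord (X q)].
have Sq : S° q by apply: filterI => //; exact: open_nbhs_nbhs.
have xS : nbhs (x q) (x @` S°).
  apply: open_nbhs_nbhs; split; last by exists q.
  by apply: openx => [y /interior_subset[]//|]; exact: open_interior.
by apply: filterS xS => _ [y /interior_subset[_ ty] <-].
Qed.

Lemma derive_dot n (Y : 'rV[R]_2 -> 'rV[R]_n) q h : differentiable Y q ->
  'D_h (fun y => dot (Y y) (Y y)) q = 2 * dot (Y q) ('D_h Y q).
Proof.
move=> /(@diff_derivable _ _ _ _ _ h) dY.
have dYi i : is_derive q h (fun y => Y y 0 i) ('D_h Y q 0 i).
  by split; [exact: (derivable_mxP _ _ _).1|rewrite derive_mx// mxE].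
have -> : (fun y => dot (Y y) (Y y)) =
    \sum_(i < n) ((fun y => Y y 0 i) * (fun y => Y y 0 i)).
  by apply/funext => y; rewrite fct_sumE.
rewrite (@derive_val _ _ _ _ _ _ _
  (is_derive_sum (fun i => is_deriveM (dYi i) (dYi i)))).
rewrite /dot mulr_sumr; apply: eq_bigr => i _.
by rewrite /GRing.scale /=; ring.
Qed.

Lemma r3part_is_linear : linear (r3part : 'rV[R]_4 -> 'rV[R]_3).
Proof. exact: r3partP. Qed.

HB.instance Definition _ :=
  GRing.isLinear.Build R 'rV[R]_4 'rV[R]_3 _ r3part r3part_is_linear.

Lemma dot_sphere_partial X U q i : open U -> smooth_on U X -> U q ->
  (forall y, U y -> S2xR (X y)) ->
  dot (r3part (X q)) (r3part (partial i X q)) = 0.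
Proof.
move=> oU smX Uq S2X.
have dX : differentiable X q by exact: smooth_differentiable smX Uq.
have dr : differentiable (r3part \o X) q.
  apply: differentiable_comp => //.
  exact/linear_differentiable/row_linear_continuous.
have := derive_dot (delta_mx 0 i) dr.
rewrite (derive_row_linear _ r3part dX) -/(partial i X q) /=.
have -> : 'D_(delta_mx 0 i) (fun y => dot (r3part (X y)) (r3part (X y))) q = 0.
  rewrite -(derive_cst (1 : R) q (delta_mx 0 i)); apply: near_eq_derive.
  by apply: near_open oU Uq _ => y /S2X.
by move=> /esym/eqP; rewrite mulf_eq0 pnatr_eq0 /= => /eqP.
Qed.

(** The tangent vectors of a surface in a slice, the position vector [(v, 0)] and
    the vertical unit vector are linearly independent, hence span the ambient
    space. A normal [N] is orthogonal to the first two kinds, so the horizontal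
    part of [N], written in this basis, is a combination of vectors orthogonal
    to [N]: the vertical coefficient vanishes as the part is horizontal. *)
Lemma slice_normal_vertical X U q N (t0 : R) : open U -> smooth_on U X -> U q ->
  injective ('d X q) -> (forall y, U y -> slice t0 (X y)) ->
  unit_normal X q N -> r3part N = 0.
Proof.
move=> oU smX Uq dinj slX [_ NX NT].
have dX : differentiable X q by exact: smooth_differentiable smX Uq.
pose v := r3part (X q).
have vv : dot v v = 1 by have [] := slX q Uq.
have vT i : dot v (r3part (partial i X q)) = 0.
  by apply: dot_sphere_partial oU smX Uq _ => y /slX[].
have tT i : tcoord (partial i X q) = 0.
  rewrite /partial -derive_tcoord// -(derive_cst t0 q (delta_mx 0 i)).
  by apply: near_eq_derive; apply: near_open oU Uq _ => y /slX[].
(* [comb] sends coefficients to combinations of the four vectors. *)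
pose w (c : 'rV[R]_4) : 'rV[R]_2 := \row_j [:: c 0 0; c 0 1]`_j.
pose comb (c : 'rV[R]_4) := 'D_(w c) X q + pt4 (c 0 2 *: v) (c 0 3).
have comb_linear : linear comb.
  move=> a c d; rewrite /comb !derive_partials// scalerDr addrACA.
  rewrite -pt4P !mxE scalerDl -!scalerA; congr (_ + _).
  rewrite scaler_sumr -big_split /=; apply: eq_bigr => i _.
  rewrite scalerA -scalerDl; congr (_ *: _); rewrite !mxE.
  by case: i => -[|[|//]] /=.
pose Lm := GRing.isLinear.Build R 'rV[R]_4 'rV[R]_4 _ comb comb_linear.
pose L : {linear 'rV[R]_4 -> 'rV[R]_4} := HB.pack comb Lm.
have r3comb c : r3part (comb c) = r3part ('D_(w c) X q) + c 0 2 *: v.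
  by rewrite raddfD /= r3part_pt4.
have tcomb c : tcoord (comb c) = c 0 3.
  rewrite raddfD /= tcoord_pt4 derive_partials// linear_sum big1 ?add0r// => i _.
  by rewrite linearZZ /= tT scaler0.
have vD c : dot v (r3part ('D_(w c) X q)) = 0.
  rewrite derive_partials// !linear_sum big1// => i _.
  by rewrite linearZZ /= linearZZ /= vT scaler0.
have freeL : row_free (lin1_mx L).
  apply: inj_row_free => c; rewrite mul_rV_lin1 /= => c0.
  have c3 : c 0 3 = 0 by rewrite -tcomb c0 raddf0.
  have c2 : c 0 2 = 0.
    have := congr1 (dot v \o r3part) c0; rewrite /= r3comb !raddf0 raddfD /=.
    by rewrite vD add0r linearZZ /= vv [_ *: _]mulr1.
  have wc : w c = 0.
    apply: dinj; rewrite linear0 -c0 /comb c2 c3 scale0r deriveE//.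
    by rewrite -[LHS]addr0; congr (_ + _); apply: row4P;
       rewrite ?r3part_pt4 ?tcoord_pt4 raddf0.
  have c0' : c 0 0 = 0 by have := congr1 (fun u : 'rV[R]_2 => u 0 0) wc; rewrite !mxE.
  have c1 : c 0 1 = 0 by have := congr1 (fun u : 'rV[R]_2 => u 0 1) wc; rewrite !mxE.
  apply: row4P; last by rewrite raddf0.
  by apply: row3P; rewrite ?r3part0 ?r3part1 ?r3part2 mxE.
have fullL : row_full (lin1_mx L) by rewrite row_full_unit -row_free_unit.
have /submxP [c cE] : (pt4 (r3part N) 0 <= lin1_mx L)%MS by exact: submx_full.
move: cE; rewrite mul_rV_lin1 /= => cE.
have c3 : c 0 3 = 0 by rewrite -tcomb -cE tcoord_pt4.
apply: dot_eq0; have : dot N (comb c) = 0.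
  rewrite raddfD /= dot_derive0// add0r c3.
  have -> : pt4 (c 0 2 *: v) 0 = c 0 2 *: pt4 v 0.
    apply: row4P; first by rewrite linearZZ /= !r3part_pt4.
    by rewrite linearZZ /= !tcoord_pt4 [RHS]mulr0.
  by rewrite linearZZ /= NX scaler0.
rewrite -cE dot4E r3part_pt4 tcoord_pt4 mulr0 addr0.
by [].
Qed.

(** A slice is totally geodesic with vertical normal, while [R] is horizontal:
    both sides of the soliton equation vanish. *)
Lemma slice_soliton (M : topologicalType) (psi : M -> 'rV[R]_4) (t0 : R) :
  (forall m, slice t0 (psi m)) -> R_soliton psi.
Proof.
move=> slpsi U x [oU _ _ _ [smx dinj]] q Uq N nN; set X := psi \o x.
have N0 : r3part N = 0.
  apply: (slice_normal_vertical oU smx Uq (dinj q Uq) _ nN) => y _.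
  exact: slpsi.
have II0 : second_form X q N = 0.
  apply/matrixP => i j; rewrite !mxE dot4E N0 raddf0 add0r.
  rewrite (_ : tcoord _ = 0) ?mul0r//.
  have dT : differentiable (partial j X) q.
    exact: smooth_partial_differentiable smx Uq.
  rewrite /partial -derive_tcoord// -(derive_cst (0 : R) q (delta_mx 0 i)).
  apply: near_eq_derive; apply: near_open oU Uq _ => y Uy /=.
  rewrite /cst -derive_tcoord; last exact: smooth_differentiable smx Uy.
  rewrite -(derive_cst t0 y (delta_mx 0 j)); congr ('D_ _ _ _).
  by apply/funext => z; have [] := slpsi (x z).
have -> : dot N (Rfield (psi (x q))) = 0.
  by rewrite dot4E N0 RfieldE tcoord_pt4 mulr0 addr0 dotC raddf0.
exists 0, 0; split; last by rewrite addr0.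
rewrite /principal_curvatures /shape_operator II0 mulmx0 subr0 -expr2.
rewrite /char_poly /char_poly_mx map_mx0 subr0 det_scalar.
by [].
Qed.

End Slices.

(** * Solitons invariant under the rotations about an axis *)

Section RotationalSolitons.
Context {R : realType} {M : topologicalType}.
Variables (psi : M -> 'rV[R]_4) (e : 'rV[R]_3) (Phi : R -> M -> M).
Hypotheses (ee : dot e e = 1)
  (Phi_cont : continuous (fun am : R * M => Phi am.1 am.2))
  (Phi0 : forall m, Phi 0 m = m)
  (PhiD : forall a b m, Phi (a + b) m = Phi a (Phi b m))
  (psi_Phi : forall a m, psi (Phi a m) = rot4 e a (psi m)).

Lemma orbit_continuous m : continuous (fun a => Phi a m).
Proof.
move=> a.
have am : (b, m) @[b --> a] --> (a, m).
  by apply: (@cvg_pair _ _ _ _ (nbhs a) (nbhs m)); [exact: cvg_id|exact: cvg_cst].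
exact: cvg_comp am (@Phi_cont (a, m)).
Qed.

Lemma time_map_continuous a : continuous (Phi a).
Proof.
move=> m.
have am : (a, m') @[m' --> m] --> (a, m).
  by apply: (@cvg_pair _ _ _ _ (nbhs a) (nbhs m)); [exact: cvg_cst|exact: cvg_id].
exact: cvg_comp am (@Phi_cont (a, m)).
Qed.

Lemma time_mapK a : cancel (Phi a) (Phi (- a)).
Proof. by move=> m; rewrite -PhiD addNr Phi0. Qed.

Lemma time_mapVK a : cancel (Phi (- a)) (Phi a).
Proof. by move=> m; rewrite -PhiD subrr Phi0. Qed.

Lemma local_param_time_map a U x :
  local_param psi U x -> local_param psi U (Phi a \o x).
Proof.
apply: local_param_symmetry (@time_mapK a) (@time_mapVK a) _ (psi_Phi a).
- exact: time_map_continuous.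
- exact: time_map_continuous.
- exact: rot4_inj.
Qed.

Lemma rotation_field_tangent U x q N : local_param psi U x -> U q ->
  unit_normal (psi \o x) q N ->
  dot (r3part N) (cross e (r3part (psi (x q)))) = 0.
Proof.
move=> px Uq [_ _ NT].
suff : dot N (pt4 (cross e (r3part (psi (x q)))) 0) = 0.
  by rewrite dot4E r3part_pt4 tcoord_pt4 mulr0 addr0.
apply: (normal_orth_velocity (c := fun a => Phi a (x q)) px Uq) => //.
  exact: orbit_continuous.
rewrite (_ : psi \o _ = (fun a => rot4 e a (psi (x q)))).
  exact: is_derive_rot4.
by apply/funext => a /=.
Qed.

Lemma dot_Rfield (N p : 'rV[R]_4) :
  dot N (Rfield p) = dot e_z (cross (r3part p) (r3part N)).
Proof.
by rewrite dot4E RfieldE r3part_pt4 tcoord_pt4 mulr0 addr0 triple_cycl.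
Qed.

(** The mean curvature does not change along an orbit, so for a soliton neither
    does [<N, R>]; transporting the normal by the rotation, this says that
    [<e_z, rot_a (v x n)>] does not depend on [a]. *)
Lemma soliton_Rfield_invariant a U x q N : R_soliton psi ->
  local_param psi U x -> U q -> unit_normal (psi \o x) q N ->
  dot e_z (rot3 e a (cross (r3part (psi (x q))) (r3part N))) =
  dot e_z (cross (r3part (psi (x q))) (r3part N)).
Proof.
move=> sol px Uq nN; have [oU _ _ _ [smx _]] := px.
have psiE : psi \o (Phi a \o x) = rot4 e a \o (psi \o x).
  by apply/funext => y /=.
have nN' : unit_normal (psi \o (Phi a \o x)) q (rot4 e a N).
  by rewrite psiE; exact: unit_normal_rot4 oU smx Uq nN.
have H1 := sol _ _ (@local_param_time_map a _ _ px) q Uq _ nN'.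
have H2 := sol _ _ px q Uq _ nN.
have SE : shape_operator (psi \o (Phi a \o x)) q (rot4 e a N) =
          shape_operator (psi \o x) q N.
  rewrite psiE; apply: (shape_operator_isometry (L := rot4 e a) _ oU smx) => //.
  by move=> p n; exact: rot4_dot.
have := mean_curvature_unique SE H1 H2.
by rewrite !dot_Rfield /= psi_Phi !r3part_rot4 rot3_cross.
Qed.

Lemma orthogonal_frame_eq0 (c : 'rV[R]_3) : ~ is_z_axis e ->
  dot e c = 0 -> dot e_z c = 0 -> dot e_z (cross e c) = 0 -> c = 0.
Proof.
move=> nz; rewrite !dot3E !ezE !crossE !mul0r !add0r !mul1r => ec c2.
rewrite c2 mulr0 addr0 in ec.
move=> exc; have [s0|s0] := eqVneq (e 0 0 ^+ 2 + e 0 1 ^+ 2) 0.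
  have /eqP/[!paddr_eq0] := s0; rewrite ?sqr_ge0// !sqrf_eq0.
  move=> /andP[/eqP e0 /eqP e1].
  exfalso; apply: nz; move: ee; rewrite dot3E e0 e1 !mul0r !add0r -expr2.
  move=> /eqP; rewrite sqrf_eq1 => /orP[] /eqP e2.
    by left; apply: row3P; rewrite ?ezE.
  by right; apply: row3P; rewrite mxE ?ezE ?oppr0.
apply: row3P; rewrite ?c2 mxE//.
  apply: (mulfI s0); rewrite mulr0.
  transitivity (e 0 0 * (e 0 0 * c 0 0 + e 0 1 * c 0 1)
    - e 0 1 * (e 0 0 * c 0 1 - e 0 1 * c 0 0)); first by ring.
  by rewrite ec exc !mulr0 subr0.
apply: (mulfI s0); rewrite mulr0.
transitivity (e 0 1 * (e 0 0 * c 0 0 + e 0 1 * c 0 1)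
    + e 0 0 * (e 0 0 * c 0 1 - e 0 1 * c 0 0)); first by ring.
by rewrite ec exc !mulr0 addr0.
Qed.

(** Put [c = v x n]. It is orthogonal to [e] because the rotation field is
    tangent, and then [<e_z, rot_a c> = cos a <e_z, c> + sin a <e_z, e x c>] is
    constant in [a] only if both coefficients vanish. As [e_z] is not a multiple
    of [e], this leaves [c = 0]: [n] is parallel to [v], and also orthogonal to
    it. *)
Lemma soliton_normal_vertical U x q N : ~ is_z_axis e -> R_soliton psi ->
  local_param psi U x -> U q -> S2xR (psi (x q)) ->
  unit_normal (psi \o x) q N -> r3part N = 0.
Proof.
move=> nz sol px Uq vv nN; have [_ NX _] := nN.
set v := r3part (psi (x q)) in vv NX *; set n := r3part N in NX *.
have ec : dot e (cross v n) = 0.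
  by rewrite -triple_cycl; exact: rotation_field_tangent px Uq nN.
have inv a := soliton_Rfield_invariant a sol px Uq nN.
(* Half a turn changes the sign of [c], and a quarter turn maps it to [e x c]. *)
have zc : dot e_z (cross v n) = 0.
  have := inv pi; rewrite -/v -/n /rot3 cospi sinpi ec mulr0 !scale0r !addr0.
  rewrite linearZZ /= [_ *: _]mulN1r => /eqP.
  by rewrite eq_sym -subr_eq0 opprK -mulr2n mulrn_eq0 /= => /eqP.
have zec : dot e_z (cross e (cross v n)) = 0.
  have := inv (pi / 2); rewrite -/v -/n /rot3 cos_pihalf sin_pihalf ec mulr0.
  by rewrite !scale0r add0r addr0 scale1r zc.
have c0 := orthogonal_frame_eq0 nz ec zc zec.
have nv : dot n v = 0.
  by move: NX; rewrite dot4E r3part_pt4 tcoord_pt4 mulr0 addr0.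
apply: dot_eq0; rewrite -[LHS]mul1r -[1]vv.
transitivity (dot (cross v n) (cross v n) + dot n v ^+ 2).
  by rewrite !dot3E !crossE; ring.
by rewrite c0 nv raddf0 add0r expr0n.
Qed.

End RotationalSolitons.

(** * Classification *)

Section Classification.
Context {R : realType} {M : topologicalType}.
Implicit Types (psi : M -> 'rV[R]_4) (e n v : 'rV[R]_3).

Lemma z_axis_cross e n v : is_z_axis e ->
  dot n (cross e v) = 0 -> dot n (cross e_z v) = 0.
Proof.
case=> [-> //|->]; rewrite !dot3E !crossE ![(- e_z) _ _]mxE => h.
by apply: oppr_inj; rewrite oppr0 -h; ring.
Qed.

(** When [e] is vertical, [R] is the tangent rotation field up to sign, so the
    soliton equation reads [H = 0]. Otherwise every normal is vertical, so the
    height has zero derivative in every chart and is constant by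
    connectedness. *)
Lemma soliton_classification psi e : immersed_surface psi -> dot e e = 1 ->
  rotational psi e ->
  (R_soliton psi <->
    (exists t0 : R, forall m : M, slice t0 (psi m)) \/
    (is_z_axis e /\ minimal_surface psi)).
Proof.
move=> [_ conn S2psi charts] ee [Phi [Phi_cont Phi0 PhiD psi_Phi]].
have normalR U x q N : is_z_axis e -> local_param psi U x -> U q ->
    unit_normal (psi \o x) q N -> dot N (Rfield (psi (x q))) = 0.
  move=> ze px Uq nN; rewrite dot_Rfield -triple_cycl.
  apply: (z_axis_cross ze).
  exact: (rotation_field_tangent Phi_cont Phi0 psi_Phi px Uq nN).
split=> [sol|[[t0 slpsi]|[ze mini]]].
- have [ze|nze] := pselect (is_z_axis e).
    right; split=> // U x px q Uq N nN.
    have := sol _ _ px q Uq N nN; rewrite (normalR _ _ _ _ ze px Uq nN).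
    exact.
  left; have [[m0 _]|/forallNP M0] := pselect (exists m : M, True); last first.
    by exists 0 => m; case: (M0 m).
  exists (tcoord (psi m0)) => m; split; first exact: S2psi.
  apply: (locally_constant_connected (f := tcoord \o psi) conn).
  apply: (locally_constant_tcoord charts) => U x px q Uq i.
  have [N nN] := exists_unit_normal (psi \o x) q.
  have [NN _ NT] := nN.
  have n0 : r3part N = 0.
    exact: (soliton_normal_vertical ee Phi_cont Phi0 PhiD psi_Phi nze sol px Uq).
  have tN : tcoord N != 0.
    apply/eqP => tN; move: NN; rewrite dot4E n0 tN mulr0 raddf0 addr0.
    by move=> /eqP; rewrite eq_sym oner_eq0.
  have := NT i; rewrite dot4E n0 dotC raddf0 add0r.
  by move=> /eqP; rewrite mulf_eq0 (negPf tN) => /eqP.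
- exact: slice_soliton slpsi.
- move=> U x px q Uq N nN; rewrite (normalR _ _ _ _ ze px Uq nN).
  exact: mini px q Uq N nN.
Qed.

End Classification.

(** * Stereographic coordinates *)

Section Stereographic.
Context {R : realType}.
Implicit Types (q h : 'rV[R]_2) (eps : R).

Definition stereo_den q : R := 1 + q 0 0 ^+ 2 + q 0 1 ^+ 2.

Lemma stereo_den_gt0 q : 0 < stereo_den q.
Proof. by rewrite /stereo_den -addrA ltr_pwDl// addr_ge0// sqr_ge0. Qed.

(** Infinite differentiability of stereographic coordinates: they belong to the
    algebra generated by the coordinates and the inverse of the denominator,
    whose elements are differentiable, and which is stable under directional
    derivatives. *)
Inductive stereo_fun : ('rV[R]_2 -> R) -> Prop :=
| stereo_cst c : stereo_fun (cst c)
| stereo_coord i : stereo_fun (fun q => q 0 i)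
| stereo_inv : stereo_fun (fun q => (stereo_den q)^-1)
| stereo_add f g : stereo_fun f -> stereo_fun g -> stereo_fun (f + g)
| stereo_mul f g : stereo_fun f -> stereo_fun g -> stereo_fun (f * g).

Lemma is_derive_coord i q h : is_derive q h (fun y : 'rV[R]_2 => y 0 i) (h 0 i).
Proof.
have := is_derive_id q h => -[d E]; split; first exact: (derivable_mxP _ _ _).1.
by have := derive_mx d => /(congr1 (fun v : 'rV[R]_2 => v 0 i)); rewrite mxE E.
Qed.

Lemma stereo_denE : stereo_den =
  cst 1 + (fun q => q 0 0) * (fun q => q 0 0) + (fun q => q 0 1) * (fun q => q 0 1).
Proof. by apply/funext => y; rewrite !fctE /stereo_den !expr2. Qed.

Lemma differentiable_stereo_den q : differentiable stereo_den q.
Proof.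
rewrite stereo_denE.
apply: differentiableD; last by apply: differentiableM; exact: differentiable_coord.
apply: differentiableD; first exact: differentiable_cst.
by apply: differentiableM; exact: differentiable_coord.
Qed.

Lemma derive_stereo_den q h :
  'D_h stereo_den q = 2 * (h 0 0 * q 0 0 + h 0 1 * q 0 1).
Proof.
have d0 := is_derive_coord 0 q h; have d1 := is_derive_coord 1 q h.
rewrite stereo_denE (@derive_val _ _ _ _ _ _ _ (is_deriveD
  (is_deriveD (is_derive_cst (1 : R) q h) (is_deriveM d0 d0)) (is_deriveM d1 d1))).
by rewrite /GRing.scale /=; ring.
Qed.

Lemma stereo_fun_differentiable f q : stereo_fun f -> differentiable f q.
Proof.
elim=> {f} [c|i||f g _ df _ dg|f g _ df _ dg].
- exact: differentiable_cst.
- exact: differentiable_coord.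
- apply: differentiableV; first exact: differentiable_stereo_den.
  by rewrite gt_eqF// stereo_den_gt0.
- exact: differentiableD.
- exact: differentiableM.
Qed.

Lemma stereo_fun_derive f h : stereo_fun f -> stereo_fun ('D_h f).
Proof.
elim=> {f} [c|i||f g sf df sg dg|f g sf df sg dg].
- rewrite (_ : 'D_h _ = cst 0); first exact: stereo_cst.
  by apply/funext => q; rewrite derive_cst.
- rewrite (_ : 'D_h _ = cst (h 0 i)); first exact: stereo_cst.
  by apply/funext => q; rewrite (@derive_val _ _ _ _ _ _ _ (is_derive_coord i q h)).
- rewrite (_ : 'D_h _ = cst (- 2)
    * ((fun q => (stereo_den q)^-1) * (fun q => (stereo_den q)^-1))
    * (cst (h 0 0) * (fun q => q 0 0) + cst (h 0 1) * (fun q => q 0 1))).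
    by do ?[apply: stereo_mul|apply: stereo_add|exact: stereo_cst|
            exact: stereo_inv|exact: stereo_coord].
  apply/funext => q; rewrite deriveV ?derive_stereo_den.
  + rewrite !fctE /cst /GRing.scale /= expr2 invfM.
    by ring.
  + by rewrite gt_eqF// stereo_den_gt0.
  + exact/diff_derivable/differentiable_stereo_den.
- rewrite (_ : 'D_h _ = 'D_h f + 'D_h g); first exact: stereo_add.
  apply/funext => q.
  by rewrite deriveD//; apply/diff_derivable/stereo_fun_differentiable.
- rewrite (_ : 'D_h _ = f * 'D_h g + g * 'D_h f).
    by apply: stereo_add; apply: stereo_mul.
  apply/funext => q.
  by rewrite deriveM//; apply/diff_derivable/stereo_fun_differentiable.
Qed.

Lemma stereo_fun_smooth n (U : set 'rV[R]_2) (X : 'rV[R]_2 -> 'rV[R]_4) :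
  (forall j, stereo_fun (fun q => X q 0 j)) -> ntimes_differentiable_on n U X.
Proof.
elim: n X => //= n IH X sX.
have dX q : differentiable X q.
  by apply: differentiable_rV => j; exact: stereo_fun_differentiable.
split=> [q _|v]; first exact: dX.
apply: IH => j; rewrite (_ : (fun q => _) = 'D_v (fun q => X q 0 j)).
  exact: stereo_fun_derive.
by apply/funext => q; rewrite derive_mx ?mxE//; exact: diff_derivable.
Qed.

(** [eps = 1] and [eps = -1] give the inverses of the stereographic projections
    from the two poles. *)
Definition stereo eps (t0 : R) q : 'rV[R]_4 :=
  let w := (stereo_den q)^-1 in
  pt4 (\row_i [:: 2 * q 0 0 * w; 2 * q 0 1 * w; eps * (1 - 2 * w)]`_i) t0.

Definition stereo_proj eps (p : 'rV[R]_4) : 'rV[R]_2 :=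
  \row_i [:: p 0 0 / (1 - eps * p 0 2); p 0 1 / (1 - eps * p 0 2)]`_i.

Section Chart.
Variables (eps t0 : R).
Local Notation w := (fun q => (stereo_den q)^-1).

Lemma stereo0 : (fun q => stereo eps t0 q 0 0) = cst 2 * (fun q => q 0 0) * w.
Proof. by apply/funext => q; rewrite -r3part0 r3part_pt4 mxE. Qed.

Lemma stereo1 : (fun q => stereo eps t0 q 0 1) = cst 2 * (fun q => q 0 1) * w.
Proof. by apply/funext => q; rewrite -r3part1 r3part_pt4 mxE. Qed.

Lemma stereo2 : (fun q => stereo eps t0 q 0 2) = cst eps * (cst 1 + cst (- 2) * w).
Proof.
apply/funext => q; rewrite -r3part2 r3part_pt4 mxE /= !fctE /cst.
by rewrite mulNr.
Qed.

Lemma stereo3 : (fun q => stereo eps t0 q 0 3) = cst t0.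
Proof. by apply/funext => q; exact: tcoord_pt4. Qed.

Lemma stereo_fun_stereo j : stereo_fun (fun q => stereo eps t0 q 0 j).
Proof.
case: j => -[|[|[|[|//]]]] j4.
- rewrite (_ : Ordinal j4 = 0) ?stereo0; last exact/val_inj.
  by do ?[apply: stereo_mul|exact: stereo_cst|exact: stereo_inv|exact: stereo_coord].
- rewrite (_ : Ordinal j4 = 1) ?stereo1; last exact/val_inj.
  by do ?[apply: stereo_mul|exact: stereo_cst|exact: stereo_inv|exact: stereo_coord].
- rewrite (_ : Ordinal j4 = 2) ?stereo2; last exact/val_inj.
  by do ?[apply: stereo_mul|apply: stereo_add|exact: stereo_cst|exact: stereo_inv].
- rewrite (_ : Ordinal j4 = 3) ?stereo3; last exact/val_inj.
  exact: stereo_cst.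
Qed.

Lemma stereo_differentiable q : differentiable (stereo eps t0) q.
Proof.
apply: differentiable_rV => j; apply: stereo_fun_differentiable.
exact: stereo_fun_stereo.
Qed.

Hypothesis eps2 : eps ^+ 2 = 1.

Lemma stereo_slice q : slice t0 (stereo eps t0 q).
Proof.
split; last by rewrite /= tcoord_pt4.
rewrite /S2xR /= r3part_pt4 dot3E !mxE /=.
have d0 : stereo_den q != 0 by rewrite gt_eqF// stereo_den_gt0.
have wd : stereo_den q * (stereo_den q)^-1 = 1 by rewrite mulfV.
move: (stereo_den q)^-1 wd => v; rewrite /stereo_den => vd.
transitivity (4 * v * ((1 + q 0 0 ^+ 2 + q 0 1 ^+ 2) * v) - 4 * v ^+ 2
   + eps ^+ 2 * (1 - 2 * v) ^+ 2); first by ring.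
by rewrite vd eps2; ring.
Qed.

Lemma stereoK q : stereo_proj eps (stereo eps t0 q) = q.
Proof.
have w0 : (stereo_den q)^-1 != 0 by rewrite invr_eq0 gt_eqF// stereo_den_gt0.
have zE : 1 - eps * stereo eps t0 q 0 2 = 2 * (stereo_den q)^-1.
  rewrite -r3part2 r3part_pt4 mxE /= mulrA -expr2 eps2; ring.
apply/rowP => -[[|[|//]] j2]; rewrite mxE /= zE.
- rewrite (_ : Ordinal j2 = 0) -?r3part0 ?r3part_pt4 ?mxE /=; last exact/val_inj.
  by field; rewrite gt_eqF// stereo_den_gt0.
- rewrite (_ : Ordinal j2 = 1) -?r3part1 ?r3part_pt4 ?mxE /=; last exact/val_inj.
  by field; rewrite gt_eqF// stereo_den_gt0.
Qed.

Lemma stereo_projK p : slice t0 p -> 1 - eps * p 0 2 != 0 ->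
  stereo eps t0 (stereo_proj eps p) = p.
Proof.
move=> [pS pt]; move: pS; rewrite /S2xR /= dot3E !r3part0 !r3part1 !r3part2.
set x := p 0 0; set y := p 0 1; set z := p 0 2 => pS d0.
have denE : (stereo_den (stereo_proj eps p))^-1 = (1 - eps * z) / 2.
  apply: (@mulIf _ (2 / (1 - eps * z))).
    by rewrite mulf_neq0 ?invr_eq0 ?pnatr_eq0.
  have dE : stereo_den (stereo_proj eps p) = 2 / (1 - eps * z).
    rewrite /stereo_den !mxE /= -/x -/y -/z.
    apply: (@mulIf _ ((1 - eps * z) ^+ 2)); first by rewrite sqrf_eq0.
    transitivity ((1 - eps * z) ^+ 2 + (x * x + y * y + z * z) - z ^+ 2).
      by field.
    rewrite pS; transitivity (2 - 2 * eps * z + (eps ^+ 2 - 1) * z ^+ 2).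
      by ring.
    by rewrite eps2; field.
  by rewrite dE mulVf ?mulf_neq0 ?invr_eq0 ?pnatr_eq0//; field.
apply: row4P; last by rewrite tcoord_pt4.
apply: row3P; rewrite r3part_pt4 ?(r3part0, r3part1, r3part2) mxE /= denE;
  rewrite ?mxE /= -/x -/y -/z.
- by field.
- by field.
- transitivity (eps ^+ 2 * z); first by field.
  by rewrite eps2 mul1r.
Qed.

(** If the derivative along [h] vanishes, the third coordinate shows that the
    denominator is stationary, and then the first two that [h] is zero. *)
Lemma stereo_diff_injective q : injective ('d (stereo eps t0) q).
Proof.
have eps0 : eps != 0 by rewrite -sqrf_eq0 eps2 oner_eq0.
have dX := stereo_differentiable q.
suff ker h : 'd (stereo eps t0) q h = 0 -> h = 0.
  by move=> y z /eqP; rewrite -subr_eq0 -linearB => /eqP/ker/eqP; rewrite subr_eq0 => /eqP.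
rewrite -deriveE// => Dh0.
have Dj j : 'D_h (fun y => stereo eps t0 y 0 j) q = 0.
  have := derive_mx (diff_derivable dX : derivable _ q h).
  by rewrite Dh0 => /(congr1 (fun u : 'rV[R]_4 => u 0 j)); rewrite !mxE.
have dw : is_derive q h w ('D_h w q).
  exact/derivableP/diff_derivable/stereo_fun_differentiable/stereo_inv.
have c0 (c : R) := is_derive_cst c q h.
have w0 : (stereo_den q)^-1 != 0 by rewrite invr_eq0 gt_eqF// stereo_den_gt0.
have Dw0 : 'D_h w q = 0.
  have := Dj 2; rewrite stereo2 (@derive_val _ _ _ _ _ _ _
    (is_deriveM (c0 eps) (is_deriveD (c0 1) (is_deriveM (c0 (- 2)) dw)))).
  rewrite /GRing.scale /= /cst !mulr0 !addr0 add0r => /eqP.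
  by rewrite !mulf_eq0 (negPf eps0) oppr_eq0 pnatr_eq0 /= => /eqP.
have D01 i : 'D_h (cst 2 * (fun q => q 0 i) * w) q = 0 -> h 0 i = 0.
  rewrite (@derive_val _ _ _ _ _ _ _
    (is_deriveM (is_deriveM (c0 2) (is_derive_coord i q h)) dw)) Dw0.
  rewrite /GRing.scale /= /cst !mulr0 !add0r addr0 => /eqP.
  by rewrite !mulf_eq0 (negPf w0) pnatr_eq0 /= => /eqP.
apply/rowP => -[[|[|//]] j2]; rewrite [RHS]mxE.
- by rewrite (_ : Ordinal j2 = 0); [apply: D01; rewrite -stereo0 Dj|exact/val_inj].
- by rewrite (_ : Ordinal j2 = 1); [apply: D01; rewrite -stereo1 Dj|exact/val_inj].
Qed.

End Chart.
End Stereographic.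

(** * Slices are immersed rotational surfaces *)

Section SliceSurface.
Context {R : realType}.
Variable t0 : R.
Local Notation T := (set_type (slice t0)).
Local Notation incl := (set_val : T -> 'rV[R]_4).

Lemma incl_continuous : continuous incl.
Proof. exact: initial_continuous. Qed.

Definition stereo_chart (eps : R) (eps2 : eps ^+ 2 = 1) (q : 'rV[R]_2) : T :=
  exist _ (stereo eps t0 q) (mem_set (@stereo_slice R eps t0 eps2 q)).

Lemma slice_incl (m : T) : slice t0 (incl m).
Proof. exact: set_valP. Qed.

Section StereoChart.
Variables (eps : R) (eps2 : eps ^+ 2 = 1).
Let x := stereo_chart eps2.

Lemma stereo_chart_continuous : continuous x.
Proof.
apply: (@continuous_comp_initial T _ _ set_val) => q.
exact/differentiable_continuous/stereo_differentiable.
Qed.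

Lemma stereo_chartK (m : T) : 1 - eps * incl m 0 2 != 0 ->
  x (stereo_proj eps (incl m)) = m.
Proof.
move=> m0; apply: val_inj; apply: (stereo_projK eps2 _ m0).
exact: slice_incl.
Qed.

Lemma stereo_chart_range q : 1 - eps * incl (x q) 0 2 != 0.
Proof.
rewrite /= -r3part2 r3part_pt4 mxE /= mulrA -expr2 eps2 mul1r opprB addrCA subrr.
by rewrite addr0 mulf_neq0 ?pnatr_eq0// invr_eq0 gt_eqF// stereo_den_gt0.
Qed.

(** Stereographic projection is a continuous left inverse of the chart, and a
    true inverse off the pole, which is an open condition. *)
Lemma stereo_chart_open V : open V -> open (x @` V).
Proof.
move=> oV; rewrite openE => _ [q Vq <-].
have coordc i : incl m 0 i @[m --> x q] --> incl (x q) 0 i.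
  exact: cvg_comp (@incl_continuous (x q)) (@coord_continuous _ _ _ 0 i _).
have den_cont : 1 - eps * incl m 0 2 @[m --> x q] -->
    1 - eps * incl (x q) 0 2.
  exact: cvgB (cvg_cst _) (cvgM (cvg_cst _) (coordc 2)).
have den0 := stereo_chart_range q.
have proj_cont : stereo_proj eps (incl m) @[m --> x q] -->
    stereo_proj eps (incl (x q)).
  have quot i : incl m 0 i / (1 - eps * incl m 0 2) @[m --> x q] -->
      incl (x q) 0 i / (1 - eps * incl (x q) 0 2).
    exact: cvgM (coordc i) (cvgV den0 den_cont).
  apply: (@cvg_rV _ _ _ (nbhs_filter (x q))) => -[[|[|//]] j2]; rewrite mxE /=; under eq_fun do rewrite mxE /=.
    exact: quot.
  exact: quot.
have nV : nbhs (stereo_proj eps (incl (x q))) V.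
  by rewrite /= stereoK//; exact: open_nbhs_nbhs.
have near_den : \forall m \near x q, 1 - eps * incl m 0 2 != 0.
  exact: (den_cont _ (open_nbhs_nbhs (conj (@open_neq R 0) den0))).
near=> m; exists (stereo_proj eps (incl m)).
  by near: m; exact: proj_cont.
by apply: stereo_chartK; near: m.
Unshelve. all: by end_near. Qed.

Lemma local_param_stereo_chart :
  local_param incl [set: 'rV[R]_2] x.
Proof.
split.
- exact: openT.
- by move=> y z _ _ /(congr1 (stereo_proj eps \o incl)) /=; rewrite !stereoK.
- by move=> q _; exact: stereo_chart_continuous.
- by move=> V _; exact: stereo_chart_open.
- split=> [n|q _]; last exact: stereo_diff_injective.
  by apply: stereo_fun_smooth => j; exact: stereo_fun_stereo.
Qed.

End StereoChart.

Let one2 : (1 : R) ^+ 2 = 1. Proof. exact: expr1n. Qed.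
Let mone2 : (- 1 : R) ^+ 2 = 1. Proof. by rewrite sqrrN expr1n. Qed.

Lemma stereo_charts_cover (m : T) :
  range (stereo_chart one2) m \/ range (stereo_chart mone2) m.
Proof.
have [z1|z1] := eqVneq (1 - 1 * incl m 0 2) 0; [right|left]; last first.
  by exists (stereo_proj 1 (incl m)) => //; exact: stereo_chartK.
exists (stereo_proj (- 1) (incl m)) => //; apply: stereo_chartK.
move: z1; rewrite mul1r mulN1r opprK => /eqP; rewrite subr_eq0 => /eqP <-.
by rewrite (_ : 1 + 1 = 2)// pnatr_eq0.
Qed.

Lemma slice_hausdorff : hausdorff_space T.
Proof.
have := @norm_hausdorff R 'rV[R]_4; rewrite !open_hausdorff => H y z yz.
have vyz : incl y != incl z by apply: contra yz => /eqP/val_inj ->.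
have [[A B] /= [yA zB] [oA oB AB]] := H _ _ vyz.
have cv (C : set 'rV[R]_4) : open C -> open (incl @^-1` C).
  by move=> oC; apply: open_comp oC => w _; exact: incl_continuous.
exists (incl @^-1` A, incl @^-1` B) => /=.
  by move: yA zB; rewrite !inE.
split; [exact: cv|exact: cv|].
apply/eqP/seteqP; split=> // w [wA wB]; move/eqP/seteqP: AB => [/(_ (incl w)) AB _].
by case: AB.
Qed.

Lemma plane_connected n : connected [set: 'rV[R]_n].
Proof.
have -> : [set: 'rV[R]_n] = \bigcup_(v in [set: 'rV[R]_n]) ((fun s : R => s *: v) @` `[0, 1]).
  apply/seteqP; split=> // v _; exists v => //; exists 1; last by rewrite scale1r.
  by rewrite /= in_itv /= ler01 lexx.
apply: bigcup_connected.
  exists 0 => v _; exists 0; last by rewrite scale0r.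
  by rewrite /= in_itv /= ler01 lexx.
move=> v _; apply: connected_continuous_connected; first exact: segment_connected.
apply: continuous_subspaceT => s.
by apply: cvgZr_tmp; exact: cvg_id.
Qed.

(** The two charts have connected domains, and their images overlap on the
    equator. *)
Lemma slice_connected : connected [set: T].
Proof.
have -> : [set: T] = range (stereo_chart one2) `|` range (stereo_chart mone2).
  by apply/seteqP; split=> // m _; exact: stereo_charts_cover.
have rc eps (eps2 : eps ^+ 2 = 1) : connected (range (stereo_chart eps2)).
  apply: connected_continuous_connected; first exact: plane_connected.
  apply: continuous_subspaceT; exact: stereo_chart_continuous.
apply: connectedU; [|exact: rc|exact: rc].
pose q : 'rV[R]_2 := delta_mx 0 0.
exists (stereo_chart one2 q); split; first by exists q.
exists (stereo_proj (- 1) (incl (stereo_chart one2 q))) => //.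
apply: stereo_chartK; rewrite /= -r3part2 r3part_pt4 mxE /= /stereo_den !mxE /=.
by rewrite expr1n expr0n /= addr0 (_ : 1 + 1 = 2) // divff ?pnatr_eq0// subrr !mulr0 subr0 oner_eq0.
Qed.

Lemma slice_immersed : immersed_surface incl.
Proof.
split; [exact: slice_hausdorff|exact: slice_connected| |].
  by move=> m; have [] := slice_incl m.
move=> m; case: (stereo_charts_cover m) => mr.
- by exists setT, (stereo_chart one2); split => //; exact: local_param_stereo_chart.
- by exists setT, (stereo_chart mone2); split => //; exact: local_param_stereo_chart.
Qed.

Lemma rot4_slice e a p : dot e e = 1 -> slice t0 p -> slice t0 (rot4 e a p).
Proof.
move=> ee [pS pt]; split; last by rewrite /= tcoord_rot4.
by rewrite /S2xR /= r3part_rot4 rot3_dot.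
Qed.

(** The rotation of angle [a] is a combination of those of angles [0], [pi/2] and
    [pi], with coefficients depending on [a] only. Joint continuity in the angle
    and the point thus reduces to that of fixed linear maps; [c] is the
    projection on the fixed space of the rotations. *)
Lemma rot4_span (e : 'rV[R]_3) a p :
  let c := 2^-1 *: (p + rot4 e pi p) in
  rot4 e a p = cos a *: (p - c) + (sin a *: (rot4 e (pi / 2) p - c) + c).
Proof.
move=> c.
have tB (u v : 'rV[R]_4) : tcoord (u - v) = tcoord u - tcoord v := raddfB tcoord u v.
have rB (u v : 'rV[R]_4) : r3part (u - v) = r3part u - r3part v := raddfB r3part u v.
apply: row4P; last first.
  have tc : tcoord c = tcoord p.
    by rewrite /c linearZZ /= raddfD /= tcoord_rot4 /GRing.scale /=; field.
  by rewrite !tcoordP !tB !tcoord_rot4 tc subrr !mulr0 !add0r.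
have cE i : r3part c 0 i = dot e (r3part p) * e 0 i.
  rewrite /c linearZZ /= raddfD /= r3part_rot4 2!mxE rot3E cospi sinpi.
  by field.
rewrite !r3partP !rB !r3part_rot4; apply/rowP => i.
have mE (a' b : R) (u v n : 'rV[R]_3) : (a' *: (u - n) + (b *: (v - n) + n)) 0 i =
    a' * (u 0 i - n 0 i) + (b * (v 0 i - n 0 i) + n 0 i) by rewrite !mxE.
rewrite mE cE !rot3E cos_pihalf sin_pihalf.
by ring.
Qed.

Lemma rot4_continuous (e : 'rV[R]_3) :
  continuous (fun ap : R * 'rV[R]_4 => rot4 e ap.1 ap.2).
Proof.
move=> -[a p].
have cfst : (ap.1 : R) @[ap --> (a, p)] --> a by exact: cvg_fst.
have csnd : (ap.2 : 'rV[R]_4) @[ap --> (a, p)] --> p by exact: cvg_snd.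
have crot b : rot4 e b ap.2 @[ap --> (a, p)] --> rot4 e b p.
  have rb : rot4 e b n @[n --> p] --> rot4 e b p.
    exact: (@row_linear_continuous R 4 _ (rot4 e b : {linear _ -> _})).
  exact: cvg_comp csnd rb.
have cc : 2^-1 *: (ap.2 + rot4 e pi ap.2) @[ap --> (a, p)] -->
    2^-1 *: (p + rot4 e pi p).
  exact: cvgZ (cvg_cst _) (cvgD csnd (crot _)).
have ccos : cos ap.1 @[ap --> (a, p)] --> cos a.
  exact: cvg_comp cfst (@continuous_cos R a).
have csin : sin ap.1 @[ap --> (a, p)] --> sin a.
  exact: cvg_comp cfst (@continuous_sin R a).
rewrite /continuous_at /= rot4_span.
under eq_fun do rewrite rot4_span.
exact: cvgD (cvgZ ccos (cvgB csnd cc)) (cvgD (cvgZ csin (cvgB (crot _) cc)) cc).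
Qed.

Lemma slice_rotational e : dot e e = 1 -> rotational incl e.
Proof.
move=> ee.
exists (fun a m => exist _ (rot4 e a (incl m))
   (mem_set (rot4_slice a ee (slice_incl m)))).
split.
- apply: (@continuous_comp_initial T _ _ set_val) => -[a m].
  have am : (am.1, incl am.2) @[am --> (a, m)] --> (a, incl m).
    apply: (@cvg_pair _ _ _ _ (nbhs a) (nbhs (incl m))); first exact: cvg_fst.
    by apply: cvg_comp; [exact: cvg_snd|exact: incl_continuous].
  exact: cvg_comp am (@rot4_continuous e (a, incl m)).
- by move=> m; apply: val_inj => /=; rewrite rot4_0.
- by move=> a b m; apply: val_inj => /=; rewrite rot4_addA.
- by [].
Qed.

End SliceSurface.

Theorem theorem4p3 (R : realType) :
  (forall (M : topologicalType) (psi : M -> 'rV[R]_4) (e : 'rV[R]_3),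
     immersed_surface psi -> dot e e = 1 -> rotational psi e ->
     (R_soliton psi <->
        (exists t0 : R, forall m : M, slice t0 (psi m)) \/
        (is_z_axis e /\ minimal_surface psi))) /\
  (forall (t0 : R) (e : 'rV[R]_3), dot e e = 1 ->
     let incl : set_type (slice t0) -> 'rV[R]_4 := set_val in
     [/\ immersed_surface incl, rotational incl e & R_soliton incl]).
Proof.
split=> [M psi e|t0 e ee incl]; first exact: soliton_classification.
split; [exact: slice_immersed|exact: slice_rotational|].
by apply: (@slice_soliton _ _ _ t0) => m; exact: slice_incl.
Qed.
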